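(* (a) For every $n\ge 5$, $pr(K_n,C_5)=n+2$. (b) For every $n\ge 6$, $pr(K_n,C_6)=n+5$.
   Context: $C_k$ denotes the cycle on $k$ vertices. A subgraph of an edge-colored graph is properly colored if any two adjacent edges receive different colors. $pr(K_n,G)$ denotes the maximum number of colors in an (arbitrary) edge-coloring of the complete graph $K_n$ that contains no properly colored copy of $G$. *)

(* Defs.v *)
From mathcomp Require Import all_boot.

Set Implicit Arguments.
Unset Strict Implicit.
Unset Printing Implicit Defensive.

Definition edges (n : nat) : {set {set 'I_n}} :=
  [set e : {set 'I_n} | #|e| == 2].

(* A simple graph is a symmetric irreflexive [rel V] on a finite type [V]. *)
Definition cycle_graph (k : nat) : rel 'I_k :=
  [rel u v | (v == ordS u) || (u == ordS v)].

(* An edge-coloring of K_n is a function on all subsets of the vertex set of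
   which only the values on two-element subsets are ever used. *)
Definition num_colors (n : nat) (C : eqType) (c : {set 'I_n} -> C) : nat :=
  size (undup [seq c e | e in edges n]).

Definition properly_colored_copy (n : nat) (C : eqType) (c : {set 'I_n} -> C)
    (V : finType) (G : rel V) (f : {ffun V -> 'I_n}) : bool :=
  injectiveb f &&
  [forall u, forall v, forall w,
     [&& G u v, G u w & v != w] ==> (c [set f u; f v] != c [set f u; f w])].

Definition has_properly_colored_copy (n : nat) (C : eqType)
    (c : {set 'I_n} -> C) (V : finType) (G : rel V) : bool :=
  [exists f : {ffun V -> 'I_n}, properly_colored_copy c G f].

(* A palette with as many colors as K_n has edges loses no generality: see
   [pr_ub] below, which bounds colorings with values in any type. *)
Definition pr (n : nat) (V : finType) (G : rel V) : nat :=
  \max_(c : {ffun {set 'I_n} -> 'I_#|edges n|}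
         | ~~ has_properly_colored_copy c G) num_colors c.

Lemma cycle_graph_sym k : symmetric (@cycle_graph k).
Proof. by move=> u v; exact: orbC. Qed.

Lemma cycle_graph_irr k : 1 < k -> irreflexive (@cycle_graph k).
Proof.
move=> k_gt1 u; rewrite /cycle_graph /= orbb; apply/negbTE/eqP => /(congr1 val) /=.
have := ltn_ord u; rewrite leq_eqVlt => /orP[/eqP Eu | ltu].
  by rewrite Eu modnn => u0; move: k_gt1; rewrite -Eu u0.
by rewrite modn_small // => /n_Sn.
Qed.

Lemma pr_attained n (V : finType) (G : rel V)
    (c0 : {ffun {set 'I_n} -> 'I_#|edges n|}) :
  ~~ has_properly_colored_copy c0 G ->
  exists2 c : {ffun {set 'I_n} -> 'I_#|edges n|},
    ~~ has_properly_colored_copy c G & num_colors c = pr n G.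
Proof.
move=> c0P; rewrite /pr (bigmax_eq_arg c0) //.
by case: arg_maxnP => // c cP _; exists c.
Qed.

Lemma pr_ub n (C : eqType) (c : {set 'I_n} -> C) (V : finType) (G : rel V) :
  irreflexive G -> ~~ has_properly_colored_copy c G -> num_colors c <= pr n G.
Proof.
move=> Girr cP; have [E0 | E_gt0] := posnP #|edges n|.
  by rewrite (leq_trans (size_undup _)) // size_map -cardE E0.
pose s := undup [seq c e | e in edges n].
have sz_s : size s <= #|edges n|.
  by rewrite (leq_trans (size_undup _)) // size_map -cardE.
pose d : {ffun {set 'I_n} -> 'I_#|edges n|} :=
  [ffun e => insubd (Ordinal E_gt0) (index (c e) s)].
have mem_s e : e \in edges n -> c e \in s.
  by move=> eE; rewrite mem_undup; apply: image_f.
have dE e : e \in edges n -> val (d e) = index (c e) s.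
  move=> /mem_s es; rewrite ffunE val_insubd.
  by rewrite (leq_trans _ sz_s) // index_mem.
have d_inj e1 e2 : e1 \in edges n -> e2 \in edges n ->
    (d e1 == d e2) = (c e1 == c e2).
  move=> E1 E2; rewrite -val_eqE !dE //; apply/eqP/eqP => [Ei | -> //].
  by rewrite -(nth_index (c e1) (mem_s _ E1)) Ei nth_index ?mem_s.
have dP : ~~ has_properly_colored_copy d G.
  apply: contra cP => /existsP[f /andP[f_inj /forallP fP]].
  apply/existsP; exists f; rewrite /properly_colored_copy f_inj /=.
  apply/forallP => u; apply/forallP => v; apply/forallP => w.
  apply/implyP => uvw; have /forallP/(_ v)/forallP/(_ w) := fP u.
  have fE x : G u x -> [set f u; f x] \in edges n.
    move=> Gux; rewrite inE cards2 (inj_eq (injectiveP f f_inj)).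
    suff -> : u != x by [].
    by apply: contraTneq Gux => <-; rewrite Girr.
  by rewrite uvw; have /and3P[Guv Guw _] := uvw; rewrite d_inj ?fE.
apply: (bigmax_sup d) => //; rewrite /num_colors -/s.
rewrite -(size_map (fun x => index x s) s) -(size_map val (undup _)).
apply: uniq_leq_size.
  rewrite map_inj_in_uniq ?undup_uniq // => x y xs ys /= Exy.
  by rewrite -(nth_index x xs) Exy nth_index.
move=> i /mapP[x]; rewrite mem_undup => /imageP[e eE ->] ->.
rewrite -dE // map_f // mem_undup; exact: image_f.
Qed.

(* Main.v *)
Require Import Defs.
From mathcomp Require Import all_boot.

Set Implicit Arguments.
Unset Strict Implicit.
Unset Printing Implicit Defensive.

(** Lower bound: take a rainbow K_(k-1) and add the other vertices one by one,
    each joined to the earlier ones in a single new color; a cycle C_k must use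
    an added vertex, and the last one it uses has two edges of the same color.

    Upper bound: induct on the number of vertices, deleting a vertex whose
    removal loses at most one color; K_(k-1) has too few edges to start with.
    If no such vertex exists, every vertex x sends out edges x -> y of at least
    two colors that occur only at x.  An edge x -> y differs in color from every
    other edge at y, so a cycle is properly colored at each vertex that has an
    incoming arrow, or exactly one outgoing arrow, on the cycle.  Comparing two
    such "cherries" a <- b -> c shows that all arrows from outside a cherry end
    in that cherry, so that all vertices but two point to the same two vertices,
    and then a properly colored C_5 or C_6 is visible. *)

Lemma exists_notin (V : finType) (s : seq V) :
  size s < #|V| -> exists x, x \notin s.
Proof.
move=> lt_s; apply/existsP; rewrite -negb_forall; apply: contraL lt_s => /forallP sP.
rewrite -leqNgt cardE; apply: uniq_leq_size (enum_uniq _) _ => x _.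
exact: sP.
Qed.

Lemma mem_notin_neq (T : eqType) (s : seq T) x y :
  x \in s -> y \notin s -> x <> y.
Proof. by move=> xs /negP ys xy; apply: ys; rewrite -xy. Qed.

(** * Exclusive colors and cherries *)

Section ExclusiveColors.

Variables (V : finType) (C : eqType) (f : {set V} -> C).

Local Notation col x y := (f [set x; y]).

(** The arrow from [x] to [y]. It depends only on [x] and the color of the edge: the colors of
    arrows from [x] are those lost when [x] is deleted. *)
Definition exclusive (x y : V) : bool :=
  (x != y) && [forall u, forall v,
    (u != v) ==> (col u v == col x y) ==> (x == u) || (x == v)].

Definition cherry (b a c : V) : Prop :=
  [/\ exclusive b a, exclusive b c & col b a <> col b c].

Lemma colC x y : col x y = col y x.
Proof. by rewrite setUC. Qed.

Lemma exclusive_neq x y : exclusive x y -> x <> y.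
Proof. by case/andP => /eqP. Qed.

Lemma exclusive_color x y u v :
  exclusive x y -> u <> v -> col u v = col x y -> x = u \/ x = v.
Proof.
case/andP => _ /forallP/(_ u)/forallP/(_ v) exP /eqP uv Euv.
by move: exP; rewrite uv Euv eqxx /= => /orP[]/eqP; [left | right].
Qed.

Lemma exclusive_eq x y z :
  exclusive x y -> x <> z -> col x z = col x y -> exclusive x z.
Proof.
by move=> /andP[_ exP] /eqP xz Exz; rewrite /exclusive xz Exz.
Qed.

Lemma cherryC b a c : cherry b a c -> cherry b c a.
Proof. by case=> ba bc D; split=> //; apply: nesym. Qed.

Lemma cherry_left b a c : cherry b a c -> exclusive b a.
Proof. by case. Qed.

Lemma cherry_right b a c : cherry b a c -> exclusive b c.
Proof. by case. Qed.

Lemma cherry_color b a c : cherry b a c -> col b a <> col b c.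
Proof. by case. Qed.

Lemma cherry_leaves b a c : cherry b a c -> a <> c.
Proof. by move=> [_ _ D] ac; apply: D; rewrite ac. Qed.

(** An edge [yz] in the color of the arrow from [x] to [y] would have to contain [x]. *)
Lemma neq_in_l x y z :
  exclusive x y -> x <> z -> y <> z -> col x y <> col y z.
Proof.
move=> xy xz yz E; case: (exclusive_color xy yz (esym E)) => // E'.
exact: exclusive_neq xy E'.
Qed.

Lemma neq_in_r x y z :
  exclusive z y -> x <> z -> x <> y -> col x y <> col y z.
Proof.
move=> zy xz xy E; apply: (@neq_in_l z y x) => //; try exact: nesym.
by rewrite colC -E colC.
Qed.

(** Being an arrow from [y] depends only on the color, so an arrow and a non-arrow leaving [y]
    differ in color. *)
Lemma neq_out_l x y z :
  exclusive y x -> ~~ exclusive y z -> y <> z -> col x y <> col y z.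
Proof.
move=> yx /negP nyz yz E; apply: nyz; apply: (exclusive_eq yx yz _).
by rewrite -E colC.
Qed.

Lemma neq_out_r x y z :
  exclusive y z -> ~~ exclusive y x -> y <> x -> col x y <> col y z.
Proof.
move=> yz nyx yx E; apply: (neq_out_l yz nyx yx).
by rewrite colC -E colC.
Qed.

Definition no_proper_cycle (k : nat) : Prop :=
  forall g : 'I_k -> V, injective g ->
  exists i, col (g i) (g (ordS i)) = col (g (ordS i)) (g (ordS (ordS i))).

Lemma no_proper_cycle5 a b c d e : no_proper_cycle 5 ->
  uniq [:: a; b; c; d; e] ->
  col a b <> col b c -> col b c <> col c d -> col c d <> col d e ->
  col d e <> col e a -> col e a <> col a b -> False.
Proof.
move=> noC U ? ? ? ? ?.
have [|[i Hi]] := noC (fun i => nth a [:: a; b; c; d; e] i).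
  by move=> i j /eqP; rewrite nth_uniq // => /eqP/val_inj.
by do 5?[case: i Hi => [|i] Hi //=].
Qed.

Lemma no_proper_cycle6 a b c d e g : no_proper_cycle 6 ->
  uniq [:: a; b; c; d; e; g] ->
  col a b <> col b c -> col b c <> col c d -> col c d <> col d e ->
  col d e <> col e g -> col e g <> col g a -> col g a <> col a b -> False.
Proof.
move=> noC U ? ? ? ? ? ?.
have [|[i Hi]] := noC (fun i => nth a [:: a; b; c; d; e; g] i).
  by move=> i j /eqP; rewrite nth_uniq // => /eqP/val_inj.
by do 6?[case: i Hi => [|i] Hi //=].
Qed.

Lemma exclusive_other_color x y : (exists p q, cherry x p q) ->
  exists2 w, exclusive x w & col x w <> col x y.
Proof.
move=> [p [q [xp xq D]]]; have [E|/eqP E] := eqVneq (col x p) (col x y).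
  by exists q => //; rewrite -E; apply: nesym.
by exists p.
Qed.

Lemma cherry_only_two x p q : (exists p q, cherry x p q) ->
  (forall w, exclusive x w -> w = p \/ w = q) -> cherry x p q.
Proof.
move=> [a [b [xa xb D]]] only.
case: (only _ xa) (only _ xb) => Ea [] Eb; subst => //.
exact: cherryC.
Qed.

End ExclusiveColors.

(** Failing on a known fact is what makes the [repeat] in [harvest] stop. *)
Ltac pose_new T t :=
  lazymatch goal with
  | _ : T |- _ => fail
  | _ => have ? : T by exact: t
  end.

(* Saturates the context with the disequalities carried by [exclusive],
   [cherry], [uniq] and [\notin] hypotheses. *)
Ltac harvest := repeat
  match goal with
  | H : cherry ?f ?b ?a ?c |- _ =>
      pose_new (is_true (exclusive f b a)) (cherry_left H)
  | H : cherry ?f ?b ?a ?c |- _ =>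
      pose_new (is_true (exclusive f b c)) (cherry_right H)
  | H : cherry ?f ?b ?a ?c |- _ =>
      pose_new (f [set b; a] <> f [set b; c]) (cherry_color H)
  | H : cherry _ _ ?a ?c |- _ => pose_new (a <> c) (cherry_leaves H)
  | H : is_true (exclusive _ ?x ?y) |- _ => pose_new (x <> y) (exclusive_neq H)
  | H : is_true (uniq _) |- _ => rewrite /= !inE ?negb_or in H
  | H : is_true (_ \notin _) |- _ => rewrite !inE ?negb_or in H
  | H : is_true (_ && _) |- _ => case/andP: H => ? ?
  | H : is_true (_ != _) |- _ => move/eqP: H => ?
  end.

Ltac distinct :=
  rewrite /= ?inE ?negb_or; repeat (apply/andP; split); try done;
  apply/eqP; congruence.

(* Decides [f [set x; y] <> f [set y; z]] from the exclusive edges at [y]. *)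
Ltac proper :=
  first
  [ solve [apply: neq_in_l; [eassumption | congruence ..]]
  | solve [apply: neq_in_r; [eassumption | congruence ..]]
  | solve [apply: neq_out_l; [eassumption | eassumption | congruence]]
  | solve [apply: neq_out_r; [eassumption | eassumption | congruence]]
  | match goal with
    | |- ?f [set ?x; ?y] <> _ => rewrite (colC f x y); congruence
    end ].

(** * Five or more vertices, each with a cherry, contain a properly colored C_5 *)

Section ProperC5.

Variables (V : finType) (C : eqType) (f : {set V} -> C).
Hypothesis noC : no_proper_cycle f 5.
Hypothesis cherryP : forall x, exists p q, cherry f x p q.

Local Notation col x y := (f [set x; y]).
Local Notation "x --> y" := (exclusive f x y) (at level 70).

(** Otherwise the cycle [a b c y x] is proper: arrows enter [a], [c] and [y], and [b] is the center
    of a cherry. *)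
Lemma cherry_edge5 a b c x y : cherry f b a c -> x --> y ->
  uniq [:: a; b; c; x; y] -> col x a = col x y.
Proof.
move=> T xy U; apply/eqP; apply: contraT => /eqP D; exfalso; harvest.
by apply: (@no_proper_cycle5 _ _ f a b c y x) => //; [distinct | proper ..].
Qed.

(** Such an arrow makes [x] point to [a], [b] and [c]. Then [y] can neither have a cherry with both
    leaves among them nor point elsewhere. *)
Lemma edge_outside_cherry5 a b c x y : cherry f b a c -> x --> y ->
  ~~ uniq [:: a; b; c; x; y].
Proof.
move=> T xy; apply/negP => U.
(* By [cherry_edge5], all arrows from [x'] to the leaves or outside the cherry share one color, so
   the second color leads to [b']. *)
have xcenter a' b' c' x' y' : cherry f b' a' c' -> x' --> y' ->
    uniq [:: a'; b'; c'; x'; y'] ->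
    [/\ x' --> b', x' --> a', col x' a' = col x' y' & col x' b' <> col x' y'].
  move=> T' xy' U'; have Ea := cherry_edge5 T' xy' U'.
  have Ec : col x' c' = col x' y'.
    by apply: (cherry_edge5 (cherryC T') xy'); harvest; distinct.
  have [w xw Dw] := exclusive_other_color y' (cherryP x').
  have [Eb|/eqP Db] := eqVneq w b'; last first.
    have Da : w <> a' by congruence.
    have Dc : w <> c' by congruence.
    case: Dw; rewrite -Ea; symmetry.
    by apply: (cherry_edge5 T' xw); harvest; distinct.
  by subst w; split=> //; apply: (exclusive_eq xy' _ Ea); harvest; congruence.
have [xb xa Exa Dxb] := xcenter _ _ _ _ _ T xy U.
have Exc : col x c = col x y.
  by apply: (cherry_edge5 (cherryC T) xy); harvest; distinct.
have xc : x --> c by apply: (exclusive_eq xy _ Exc); harvest; congruence.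
(* The arrow from [x] to the vertex of [{a, b, c}] missed by the cherry at [y] yields
   [col x a = col x b], against [Dxb]. *)
have in_T p q : cherry f y p q -> p \in [:: a; b; c] -> q \in [:: a; b; c] -> False.
  move=> Ty; have Ty' := cherryC Ty; harvest; rewrite !inE.
  have E p' q' r : cherry f y p' q' -> x --> r -> uniq [:: p'; y; q'; x; r] ->
      col x p' = col x r by apply: cherry_edge5.
  have Eab : cherry f y a b \/ cherry f y c b -> col x a = col x b.
    case=> Tb; have Tb' := cherryC Tb.
      have Ea : col x a = col x c by apply: (E _ _ _ Tb xc); distinct.
      by rewrite Ea; symmetry; apply: (E _ _ _ Tb' xc); distinct.
    by symmetry; apply: (E _ _ _ Tb' xa); distinct.
  have Eac : cherry f y a c -> col x a = col x b.
    by move=> Tb; apply: (E _ _ _ Tb xb); distinct.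
  by move=> /or3P[]/eqP Ep /or3P[]/eqP Eq; subst; intuition congruence.
have [p [q Ty]] := cherryP y.
have out_T w : y --> w -> w \in [:: a; b; c].
  move=> yw; apply: contraT => wT.
  have [yb ya Eya Dyb] : [/\ y --> b, y --> a, col y a = col y w & col y b <> col y w].
    by apply: (xcenter _ _ _ _ _ T yw); harvest; distinct.
  have Tab : cherry f y a b by split=> //; congruence.
  by case: (in_T _ _ Tab); rewrite !inE eqxx ?orbT.
by case: (Ty) => yp yq _; apply: (in_T _ _ Ty); apply: out_T.
Qed.

Lemma exclusive_in_cherry5 a b c x w : cherry f b a c -> x \notin [:: a; b; c] ->
  x --> w -> w \in [:: a; b; c].
Proof.
move=> T xT xw; apply: contraT => wT.
by case/negP: (edge_outside_cherry5 T xw); harvest; distinct.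
Qed.

Lemma cherries_card_lt5 : #|V| < 5.
Proof.
rewrite ltnNge; apply/negP => V5.
have fresh (s : seq V) : size s < 5 -> exists x, x \notin s.
  by move=> lt_s; apply: exists_notin; exact: leq_trans lt_s V5.
have [b _] : exists b : V, b \notin [::] by exact: fresh.
have [a [c T]] := cherryP b.
have [x xT] : exists x, x \notin [:: a; b; c] by exact: fresh.
have [y yTx] : exists y, y \notin [:: a; b; c; x] by exact: fresh.
have yT : y \notin [:: a; b; c] by harvest; distinct.
have [p [q Tx]] := cherryP x.
have pT := exclusive_in_cherry5 T xT (cherry_left Tx).
have qT := exclusive_in_cherry5 T xT (cherry_right Tx).
have [py qy] := (mem_notin_neq pT yT, mem_notin_neq qT yT).
have y_only w : y --> w -> w = p \/ w = q.
  move=> yw; have wx := mem_notin_neq (exclusive_in_cherry5 T yT yw) xT.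
  have: w \in [:: p; x; q].
    by apply: (exclusive_in_cherry5 Tx _ yw); harvest; distinct.
  by rewrite !inE => /or3P[]/eqP; [left | | right].
have Ty := cherry_only_two (cherryP y) y_only.
(* For [z] other than [x] and [y], the cherries at [y] and at [x] confine [w] to [{p, y, q}] and to
   [{p, x, q}]. *)
have only z w : z \notin [:: p; q] -> z --> w -> w = p \/ w = q.
  move=> zpq zw; have [zy|/eqP zy] := eqVneq z y.
    by apply: y_only; rewrite -zy.
  have: w \in [:: p; y; q].
    by apply: (exclusive_in_cherry5 Ty _ zw); harvest; distinct.
  rewrite !inE => /or3P[]/eqP; [by left | move=> wy | by right].
  have [zx|/eqP zx] := eqVneq z x.
    by subst; case: (mem_notin_neq (exclusive_in_cherry5 T xT zw) yT).
  have: w \in [:: p; x; q].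
    by apply: (exclusive_in_cherry5 Tx _ zw); harvest; distinct.
  by rewrite !inE => /or3P[]/eqP E; [left | harvest; congruence | right].
have T2 z : z \notin [:: p; q] -> cherry f z p q.
  by move=> zpq; apply: cherry_only_two => // w; apply: only.
(* The cycle will be [p u q v w]: arrows enter [u], [q] and [p], and [v] and [w] each have one
   outgoing arrow on it. *)
have [u pu Du] := exclusive_other_color q (cherryP p).
have uq : u <> q by congruence.
have [v vP] : exists v, v \notin [:: p; q; u] by exact: fresh.
have [w wP] : exists w, w \notin [:: p; q; u; v] by exact: fresh.
have Tu : cherry f u p q by apply: T2; harvest; distinct.
have Tv : cherry f v p q by apply: T2; harvest; distinct.
have Tw : cherry f w p q by apply: T2; harvest; distinct.
have vw : ~~ (v --> w).
  by apply/negP => vw; case: (only v w) => //; harvest; distinct || congruence.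
have wv : ~~ (w --> v).
  by apply/negP => wv; case: (only w v) => //; harvest; distinct || congruence.
harvest.
by apply: (@no_proper_cycle5 _ _ f p u q v w) => //; [distinct | proper ..].
Qed.

End ProperC5.

(** * Six or more vertices, each with a cherry, contain a properly colored C_6 *)

Section ProperC6.

Variables (V : finType) (C : eqType) (f : {set V} -> C).
Hypothesis noC : no_proper_cycle f 6.
Hypothesis cherryP : forall x, exists p q, cherry f x p q.

Local Notation col x y := (f [set x; y]).
Local Notation "x --> y" := (exclusive f x y) (at level 70).

Ltac cycle_through a b c d e g :=
  apply: (@no_proper_cycle6 _ _ f a b c d e g) => //; [distinct | proper ..].

Lemma disjoint_cherries a b c x y z : cherry f b a c -> cherry f y x z ->
  ~~ uniq [:: a; b; c; x; y; z].
Proof. by move=> T T'; apply/negP => U; harvest; cycle_through a b c x y z. Qed.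

Lemma cherry_path a b c x y z : cherry f b a c -> x --> y -> y --> z ->
  uniq [:: a; b; c; x; y; z] -> col x a = col x y.
Proof.
move=> T xy yz U; apply/eqP; apply: contraT => /eqP D; exfalso; harvest.
by cycle_through x y z c b a.
Qed.

(** As disjoint cherries are excluded, a second arrow color at [x], and then at [y], leads to [b].
    The resulting cherries at [x] restrict the arrows from [z]. *)
Lemma path_outside_cherry_aux a b c x y z :
  cherry f b a c -> x --> y -> y --> z -> uniq [:: a; b; c; x; y; z] ->
  (forall w, z --> w -> [\/ w = x, w = y | w = b]) /\ col y a = col y z.
Proof.
move=> T xy yz U; have T' := cherryC T.
have Exa := cherry_path T xy yz U.
have Exc : col x c = col x y by apply: (cherry_path T' xy yz); harvest; distinct.
have xa : x --> a by apply: (exclusive_eq xy _ Exa); harvest; congruence.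
have xc : x --> c by apply: (exclusive_eq xy _ Exc); harvest; congruence.
have [w xw Dxw] := exclusive_other_color y (cherryP x).
have Exw : w = b.
  apply/eqP; apply: contraT => /eqP wb.
  have Tx : cherry f x y w by split=> //; apply: nesym.
  by case/negP: (disjoint_cherries T Tx); harvest; distinct.
subst w.
have Txa : cherry f x b a by split=> //; congruence.
have Txc : cherry f x b c by split=> //; congruence.
have [w yw Dyw] := exclusive_other_color z (cherryP y).
have Eyw : w = b.
  apply/eqP; apply: contraT => /eqP wb.
  have Ty : cherry f y z w by split=> //; apply: nesym.
  have [wa|/eqP wa] := eqVneq w a.
    by subst w; case/negP: (disjoint_cherries Txc Ty); harvest; distinct.
  have [wc|/eqP wc] := eqVneq w c.
    by subst w; case/negP: (disjoint_cherries Txa Ty); harvest; distinct.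
  by case/negP: (disjoint_cherries T Ty); harvest; distinct.
subst w; split; last first.
  apply/eqP; apply: contraT => /eqP D; exfalso; harvest.
  by cycle_through x b a y z c.
move=> w zw.
have [wx|/eqP wx] := eqVneq w x; first by constructor 1.
have [wy|/eqP wy] := eqVneq w y; first by constructor 2.
have [wb|/eqP wb] := eqVneq w b; first by constructor 3.
(* The cherry at [x] with leaves [b] and one of [a], [c] other than [w] avoids the path from [y]
   through [z] to [w]. *)
case: Dyw; have [wc|/eqP wc] := eqVneq w c.
  by apply: (cherry_path Txa yz zw); harvest; distinct.
by apply: (cherry_path Txc yz zw); harvest; distinct.
Qed.

(** If [z] points to [x], rotating the path forces a forbidden arrow from [z] to [a]. Otherwise [z]
    points to [y], but that color recurs on the edge [ya], which misses [z]. *)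
Lemma path_outside_cherry a b c x y z : cherry f b a c -> x --> y -> y --> z ->
  ~~ uniq [:: a; b; c; x; y; z].
Proof.
move=> T xy yz; apply/negP => U.
have [z_only Eya] := path_outside_cherry_aux T xy yz U.
have [zx | zx] := boolP (z --> x).
  have U' : uniq [:: a; b; c; y; z; x] by harvest; distinct.
  have [_ Eza] := path_outside_cherry_aux T yz zx U'.
  have za : z --> a by apply: (exclusive_eq zx _ Eza); harvest; congruence.
  by harvest; case: (z_only _ za); congruence.
have zyb w : z --> w -> w = y \/ w = b.
  by move=> zw; case: (z_only _ zw) => [E | |]; [subst; case/negP: zx | left | right].
have zy := cherry_left (cherry_only_two (cherryP z) zyb); harvest.
have [||//|/nesym//] := @exclusive_color _ _ f z y y a zy.
  by congruence.
by rewrite Eya colC.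
Qed.

(** A further vertex [z] must behave like [x], so that [leaf_outside_cherry] can exchange the
    two. *)
Lemma leaf_outside_cherry_aux a b c x y z :
  cherry f b a c -> cherry f x y a -> uniq [:: a; b; c; x; y; z] ->
  [/\ cherry f z y a, col z c = col z y & ~~ (z --> b)].
Proof.
move=> T Tx U; have T' := cherryC T.
have nzb : ~~ (z --> b).
  apply/negP => zb.
  by case/negP: (path_outside_cherry Tx zb (cherry_right T)); harvest; distinct.
have nzx : ~~ (z --> x).
  apply/negP => zx.
  by case/negP: (path_outside_cherry T zx (cherry_left Tx)); harvest; distinct.
have Ezc : col z c = col z y.
  apply/eqP; apply: contraT => /eqP D; exfalso; harvest.
  by cycle_through c b a x y z.
(* Once [z] points to [y], its second arrow color can only lead to [a]. *)
suff zy : z --> y.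
  have zc : z --> c by apply: (exclusive_eq zy _ Ezc); harvest; congruence.
  have [w zw Dzw] := exclusive_other_color y (cherryP z).
  have [wa|/eqP wa] := eqVneq w a.
    by subst w; split=> //; split=> //; apply: nesym.
  have wb : w <> b by move=> E; subst; case/negP: nzb.
  have Tz : cherry f z y w by split=> //; apply: nesym.
  by case/negP: (disjoint_cherries T Tz); harvest; distinct.
apply: contraT => nzy.
have nzc : ~~ (z --> c).
  by apply: contra nzy => zc; apply: (exclusive_eq zc _); harvest; congruence.
have z_out w : z --> w -> w \notin [:: b; c; x; y].
  move=> zw; rewrite !inE; apply/negP => E.
  by case/or4P: E => /eqP E; subst;
    [case/negP: nzb | case/negP: nzc | case/negP: nzx | case/negP: nzy].
(* Here a cherry at [z] has as leaves [a] and a seventh vertex [o]. This forces an arrow from [b] to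
   [z], hence disjoint cherries at [b] and [x]. *)
have [o Tz] : exists o, cherry f z a o.
  have [p [q Tz]] := cherryP z.
  have [pa|/eqP pa] := eqVneq p a; first by exists q; rewrite -pa.
  have [qa|/eqP qa] := eqVneq q a; first by exists p; rewrite -qa; apply: cherryC.
  have pP := z_out _ (cherry_left Tz); have qP := z_out _ (cherry_right Tz).
  by case/negP: (disjoint_cherries T Tz); harvest; distinct.
have oP := z_out _ (cherry_right Tz).
have Ebz : col b z = col b a.
  apply/eqP; apply: contraT => /eqP D; exfalso; harvest.
  by cycle_through x y o z b a.
have bz : b --> z.
  by apply: (exclusive_eq (cherry_left T) _ Ebz); harvest; congruence.
have Tb : cherry f b c z.
  by split=> //; [exact: cherry_right T | harvest; congruence].
by case/negP: (disjoint_cherries Tb Tx); harvest; distinct.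
Qed.

Hypothesis V6 : 6 <= #|V|.

Lemma fresh_vertex (s : seq V) : size s < 6 -> exists x, x \notin s.
Proof. by move=> lt_s; apply: exists_notin; exact: leq_trans lt_s V6. Qed.

Lemma leaf_outside_cherry a b c x y : cherry f b a c -> cherry f x y a ->
  ~~ uniq [:: a; b; c; x; y].
Proof.
move=> T Tx; apply/negP => U.
have [z zP] : exists z, z \notin [:: a; b; c; x; y] by exact: fresh_vertex.
have Uz : uniq [:: a; b; c; x; y; z] by harvest; distinct.
have Ux : uniq [:: a; b; c; z; y; x] by harvest; distinct.
have [Tz Ezc nzb] := leaf_outside_cherry_aux T Tx Uz.
have [_ Exc nxb] := leaf_outside_cherry_aux T Tz Ux.
have xc : x --> c by apply: (exclusive_eq (cherry_left Tx) _ Exc); harvest; congruence.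
have zc : z --> c by apply: (exclusive_eq (cherry_left Tz) _ Ezc); harvest; congruence.
have nbz : ~~ (b --> z).
  apply/negP => bz.
  by case/negP: (path_outside_cherry Tx bz zc); harvest; distinct.
by harvest; cycle_through a x c y z b.
Qed.

(** The second arrow color at [x] cannot lead to a leaf by [leaf_outside_cherry], nor outside by
    [disjoint_cherries]. *)
Lemma edge_outside_cherry_center a b c x y : cherry f b a c -> x --> y ->
  uniq [:: a; b; c; x; y] -> cherry f x y b.
Proof.
move=> T xy U; have T' := cherryC T.
have [w xw Dxw] := exclusive_other_color y (cherryP x).
have Tx : cherry f x y w by split=> //; apply: nesym.
have [wb|/eqP wb] := eqVneq w b; first by rewrite -wb.
have [wa|/eqP wa] := eqVneq w a.
  by subst w; case/negP: (leaf_outside_cherry T Tx).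
have [wc|/eqP wc] := eqVneq w c.
  by subst w; case/negP: (leaf_outside_cherry T' Tx); harvest; distinct.
by case/negP: (disjoint_cherries T Tx); harvest; distinct.
Qed.

(** In the cycle [p x1 x2 q x3 x4], arrows enter [p] and [q], and each of the other vertices has
    exactly one outgoing arrow. *)
Lemma four_cherries_same_leaves p q x1 x2 x3 x4 :
  (forall x w, x \in [:: x1; x2; x3; x4] -> x --> w -> w = p \/ w = q) ->
  ~~ uniq [:: p; q; x1; x2; x3; x4].
Proof.
move=> only; apply/negP => U.
have T x : x \in [:: x1; x2; x3; x4] -> cherry f x p q.
  by move=> xP; apply: cherry_only_two => // w; apply: only.
have no x y : x \in [:: x1; x2; x3; x4] -> y <> p -> y <> q -> ~~ (x --> y).
  by move=> xP yp yq; apply/negP => xy; case: (only x y xP xy).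
have T1 : cherry f x1 p q by apply: T; rewrite !inE eqxx.
have T2 : cherry f x2 p q by apply: T; rewrite !inE eqxx !orbT.
have T3 : cherry f x3 p q by apply: T; rewrite !inE eqxx !orbT.
have T4 : cherry f x4 p q by apply: T; rewrite !inE eqxx !orbT.
harvest.
have n12 : ~~ (x1 --> x2) by apply: no; rewrite ?inE ?eqxx //; congruence.
have n21 : ~~ (x2 --> x1) by apply: no; rewrite ?inE ?eqxx ?orbT //; congruence.
have n34 : ~~ (x3 --> x4) by apply: no; rewrite ?inE ?eqxx ?orbT //; congruence.
have n43 : ~~ (x4 --> x3) by apply: no; rewrite ?inE ?eqxx ?orbT //; congruence.
by cycle_through p x1 x2 q x3 x4.
Qed.

(** With a sixth vertex [z], all of [a], [c], [x], [z] turn out to point only to [y] and [b]. *)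
Lemma edge_outside_cherry a b c x y : cherry f b a c -> x --> y ->
  ~~ uniq [:: a; b; c; x; y].
Proof.
move=> T xy; apply/negP => U.
have [z zP] : exists z, z \notin [:: a; b; c; x; y] by exact: fresh_vertex.
have Tx := edge_outside_cherry_center T xy U.
(* Any other arrow from [z'] would bring one from [z'] to [x'], and the path [z' x' y] avoids the
   cherry at [b]. *)
have only x' z' w : cherry f x' y b -> uniq [:: a; b; c; x'; y; z'] ->
    z' --> w -> w = y \/ w = b.
  move=> Tx' U' zw.
  have nzx : ~~ (z' --> x').
    apply/negP => zx.
    by case/negP: (path_outside_cherry T zx (cherry_left Tx')); harvest; distinct.
  have [|/eqP wy] := eqVneq w y; first by left.
  have [|/eqP wb] := eqVneq w b; first by right.
  have [wx|/eqP wx] := eqVneq w x'; first by subst; case/negP: nzx.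
  case/negP: nzx; apply: (cherry_right (_ : cherry f z' w x')).
  by apply: (edge_outside_cherry_center Tx' zw); harvest; distinct.
have z_only w : z --> w -> w = y \/ w = b.
  by apply: (only _ _ _ Tx); harvest; distinct.
have Tz := cherry_only_two (cherryP z) z_only.
have x_only w : x --> w -> w = y \/ w = b.
  by apply: (only _ _ _ Tz); harvest; distinct.
have leaf_only a' c' w : cherry f b a' c' -> uniq [:: a'; b; c'; x; y; z] ->
    a' --> w -> w = y \/ w = b.
  move=> T' U' aw.
  have nax : ~~ (a' --> x).
    apply/negP => ax.
    have Ta : cherry f a' x z.
      by apply: (edge_outside_cherry_center Tz ax); harvest; distinct.
    by harvest; cycle_through y z a' x b c'.
  have [|/eqP wy] := eqVneq w y; first by left.
  have [|/eqP wb] := eqVneq w b; first by right.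
  have [wx|/eqP wx] := eqVneq w x; first by subst; case/negP: nax.
  case/negP: nax; apply: (cherry_right (_ : cherry f a' w x)).
  by apply: (edge_outside_cherry_center Tx aw); harvest; distinct.
have a_only w : a --> w -> w = y \/ w = b.
  by apply: (leaf_only _ _ _ T); harvest; distinct.
have c_only w : c --> w -> w = y \/ w = b.
  by apply: (leaf_only _ _ _ (cherryC T)); harvest; distinct.
have /negP[] : ~~ uniq [:: y; b; a; c; x; z].
  by apply: four_cherries_same_leaves => v w; rewrite !inE => /or4P[]/eqP->; auto.
by harvest; distinct.
Qed.

Lemma exclusive_in_cherry a b c x w : cherry f b a c -> x \notin [:: a; b; c] ->
  x --> w -> w \in [:: a; b; c].
Proof.
move=> T xT xw; apply: contraT => wT.
by case/negP: (edge_outside_cherry T xw); harvest; distinct.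
Qed.

Lemma cherries_card6_absurd : False.
Proof.
have [b _] : exists b : V, b \notin [::] by exact: fresh_vertex.
have [a [c T]] := cherryP b.
have [x xT] : exists x, x \notin [:: a; b; c] by exact: fresh_vertex.
have [y yTx] : exists y, y \notin [:: a; b; c; x] by exact: fresh_vertex.
have [z zTxy] : exists z, z \notin [:: a; b; c; x; y] by exact: fresh_vertex.
have yT : y \notin [:: a; b; c] by harvest; distinct.
have zT : z \notin [:: a; b; c] by harvest; distinct.
have [p [q Tx]] := cherryP x.
have pT := exclusive_in_cherry T xT (cherry_left Tx).
have qT := exclusive_in_cherry T xT (cherry_right Tx).
have only u v w : cherry f u p q -> u \notin [:: a; b; c] ->
    v \notin [:: a; b; c] -> u <> v -> v --> w -> w = p \/ w = q.
  move=> Tu uT vT uv vw; have wu := mem_notin_neq (exclusive_in_cherry T vT vw) uT.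
  have [pv qv] := (mem_notin_neq pT vT, mem_notin_neq qT vT).
  have: w \in [:: p; u; q].
    by apply: (exclusive_in_cherry Tu _ vw); clear -Tu uv pv qv; harvest; distinct.
  by rewrite !inE => /or3P[]/eqP; [left | | right].
have xy : x <> y by harvest; congruence.
have xz : x <> z by harvest; congruence.
have y_only := fun w => only x y w Tx xT yT xy.
have z_only := fun w => only x z w Tx xT zT xz.
have Ty := cherry_only_two (cherryP y) y_only.
have x_only := fun w => only y x w Ty yT xT (nesym xy).
(* As [r] may lie on the first cherry, its arrows are located by the cherries at [x] and [y]. *)
have [r rP] : exists r, r \notin [:: p; q; x; y; z] by exact: fresh_vertex.
have r_only w : r --> w -> w = p \/ w = q.
  move=> rw.
  have: w \in [:: p; x; q].
    by apply: (exclusive_in_cherry Tx _ rw); harvest; distinct.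
  have: w \in [:: p; y; q].
    by apply: (exclusive_in_cherry Ty _ rw); harvest; distinct.
  by rewrite !inE => /or3P[]/eqP-> /or3P[]/eqP; auto => /nesym.
have /negP[] : ~~ uniq [:: p; q; x; y; z; r].
  by apply: four_cherries_same_leaves => v w; rewrite !inE => /or4P[]/eqP->; auto.
have [py qy] := (mem_notin_neq pT yT, mem_notin_neq qT yT).
have [pz qz] := (mem_notin_neq pT zT, mem_notin_neq qT zT).
by harvest; distinct.
Qed.

End ProperC6.

Lemma cherries_card_lt6 (V : finType) (C : eqType) (f : {set V} -> C) :
  no_proper_cycle f 6 -> (forall x, exists p q, cherry f x p q) -> #|V| < 6.
Proof.
move=> noC cherryP; rewrite ltnNge; apply/negP.
exact: cherries_card6_absurd cherryP.
Qed.

(** * Deleting a vertex, and the upper bound *)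

Section Colors.

Variables (V : finType) (C : eqType) (f : {set V} -> C).

Definition colors : seq C := undup [seq f e | e in [set e : {set V} | #|e| == 2]].

Lemma colorsP k :
  reflect (exists x y, x <> y /\ k = f [set x; y]) (k \in colors).
Proof.
rewrite mem_undup; apply: (iffP imageP) => [[e] | [x [y [/eqP xy ->]]]].
  by rewrite inE => /cards2P[x [y [/eqP xy ->]]] ->; exists x, y.
by exists [set x; y] => //; rewrite inE cards2 xy.
Qed.

Lemma size_colors : size colors <= 'C(#|V|, 2).
Proof.
by rewrite (leq_trans (size_undup _)) // size_map -cardE card_draws.
Qed.

End Colors.

(** The remaining vertices form a subtype; hence colorings live on arbitrary finite types. *)
Definition delete_vertex (V : finType) (C : Type) (f : {set V} -> C) (v : V) :
  {set {x : V | x != v}} -> C := fun A => f [set val x | x in A].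

Arguments delete_vertex {V C} f v A.

Lemma delete_vertexE (V : finType) (C : Type) (f : {set V} -> C) v x y :
  delete_vertex f v [set x; y] = f [set val x; val y].
Proof. by rewrite /delete_vertex imsetU !imset_set1. Qed.

Lemma no_proper_cycle_delete (V : finType) (C : eqType) (f : {set V} -> C) v k :
  no_proper_cycle f k -> no_proper_cycle (delete_vertex f v) k.
Proof.
move=> noC g g_inj; have [|i Ei] := noC (val \o g).
  exact: inj_comp val_inj g_inj.
by exists i; rewrite !delete_vertexE.
Qed.

(** Each color lost with [v] is that of an arrow from [v], so two lost colors make a cherry. *)
Lemma cherry_or_delete (V : finType) (C : eqType) (f : {set V} -> C) v :
  (exists p q, cherry f v p q) \/
  size (colors f) <= (size (colors (delete_vertex f v))).+1.
Proof.
set S' := colors (delete_vertex f v).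
pose N := [seq k <- colors f | k \notin S'].
have inS' x y : x <> y -> v <> x -> v <> y -> f [set x; y] \in S'.
  move=> xy /nesym/eqP vx /nesym/eqP vy; apply/colorsP.
  exists (exist _ x vx), (exist _ y vy); rewrite delete_vertexE; split=> //.
  by case.
have NP k : k \in N -> exists2 w, exclusive f v w & f [set v; w] = k.
  rewrite mem_filter => /andP[kS' /colorsP[x [y [xy Ek]]]].
  have vP u u' : u <> u' -> f [set u; u'] = k -> v = u \/ v = u'.
    move=> uu' Eu; have [|/eqP vu] := eqVneq v u; first by left.
    have [|/eqP vu'] := eqVneq v u'; first by right.
    by case/negP: kS'; rewrite -Eu; apply: inS'.
  have [w vw Ew] : exists2 w, v <> w & f [set v; w] = k.
    have [vx | vy] := vP _ _ xy (esym Ek).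
      by exists y; rewrite ?vx.
    by exists x; rewrite ?vy; [exact: nesym | rewrite setUC].
  exists w => //; apply/andP; split; first exact/eqP.
  apply/forallP => u; apply/forallP => u'; apply/implyP => /eqP uu'.
  apply/implyP => /eqP Eu; rewrite Ew in Eu.
  by have [->|->] := vP _ _ uu' Eu; rewrite eqxx ?orbT.
have N_uniq : uniq N by rewrite filter_uniq ?undup_uniq.
have [N_le1 | N_gt1] := leqP (size N) 1.
  right; apply: (@leq_trans (size (S' ++ N))); last first.
    by rewrite size_cat -addn1 leq_add2l.
  apply: uniq_leq_size.
    exact: undup_uniq.
  by move=> k kS; rewrite mem_cat mem_filter kS andbT orbN.
left; case: N N_uniq N_gt1 NP => [|k1 [|k2 N]] //= /andP[D _] _ NP.
have [p vp Ep] := NP k1 (mem_head _ _).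
have [q vq Eq] : exists2 w, exclusive f v w & f [set v; w] = k2.
  by apply: NP; rewrite !inE eqxx orbT.
exists p, q; split=> //; rewrite Ep Eq => E12.
by rewrite E12 inE eqxx in D.
Qed.

Lemma size_colors_no_proper_cycle k :
  (forall (V : finType) (C : eqType) (f : {set V} -> C), no_proper_cycle f k.+1 ->
     (forall x, exists p q, cherry f x p q) -> #|V| < k.+1) ->
  forall m (V : finType) (C : eqType) (f : {set V} -> C),
  #|V| = k + m -> no_proper_cycle f k.+1 -> size (colors f) <= 'C(k, 2) + m.
Proof.
move=> cherries_lt; elim=> [|m IHm] V C f Vm noC.
  by rewrite addn0 -{1}(addn0 k) -Vm size_colors.
have [/existsP[v le_v] | no_v] := boolP [exists v,
    size (colors f) <= (size (colors (delete_vertex f v))).+1].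
  rewrite addnS; apply: leq_trans le_v _; rewrite ltnS; apply: IHm.
    by rewrite card_sig cardC1 Vm addnS.
  exact: no_proper_cycle_delete.
have := cherries_lt V C f noC; rewrite Vm addnS ltnS ltnNge leq_addr => lt_V.
suff /lt_V : forall x, exists p q, cherry f x p q by [].
move=> v; have [//|le_v] := cherry_or_delete f v.
by case/existsP: no_v; exists v.
Qed.

Lemma no_proper_cycle_copy n (C : eqType) (c : {set 'I_n} -> C) k :
  ~~ has_properly_colored_copy c (@cycle_graph k) -> no_proper_cycle c k.
Proof.
move=> no_copy g g_inj; apply/'exists_eqP; apply: contraNT no_copy => no_eq.
pose h := [ffun i => g i]; apply/existsP; exists h; apply/andP; split.
  by apply/injectiveP => i j; rewrite !ffunE => /g_inj.
have proper i : c [set g i; g (ordS i)] != c [set g (ordS i); g (ordS (ordS i))].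
  by apply: contraNneq no_eq => E; apply/existsP; exists i; apply/eqP.
apply/forallP => u; apply/forallP => v; apply/forallP => w.
(* Each of [v], [w] is the successor or the predecessor of [u]; being distinct, they are one of
   each. *)
apply/implyP; rewrite !ffunE => /and3P[/orP[]/eqP Ev /orP[]/eqP Ew vw].
- by rewrite Ev Ew eqxx in vw.
- by rewrite Ev Ew eq_sym setUC.
- by rewrite Ew Ev setUC.
- by rewrite Ev in Ew; rewrite (ordS_inj Ew) eqxx in vw.
Qed.

Lemma pr_cycle_le k n :
  (forall (V : finType) (C : eqType) (f : {set V} -> C), no_proper_cycle f k.+1 ->
     (forall x, exists p q, cherry f x p q) -> #|V| < k.+1) ->
  k <= n -> pr n (@cycle_graph k.+1) <= 'C(k, 2) + (n - k).
Proof.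
move=> cherries_lt le_kn; apply/bigmax_leqP => c no_copy.
apply: (size_colors_no_proper_cycle cherries_lt).
  by rewrite card_ord subnKC.
exact: no_proper_cycle_copy.
Qed.

(** * The lower bound, for cycles of length [k.+1] *)

Definition nested_coloring (k n : nat) (e : {set 'I_n}) : {set 'I_n} + nat :=
  let m := \max_(i in e) (i : nat) in if m < k then inl e else inr m.

Lemma nested_coloring_max k n (x y : 'I_n) :
  k <= x -> y <= x -> nested_coloring k [set x; y] = inr (x : nat).
Proof.
move=> kx yx; rewrite /nested_coloring.
have -> : \max_(i in [set x; y]) (i : nat) = x.
  apply/eqP; rewrite eqn_leq; apply/andP; split.
    by apply/bigmax_leqP => i; rewrite !inE => /orP[]/eqP->.
  by apply: (bigmax_sup x); rewrite ?inE ?eqxx.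
by rewrite ltnNge kx.
Qed.

Lemma pr_cycle_ge k n : 1 < k -> k <= n ->
  'C(k, 2) + (n - k) <= pr n (@cycle_graph k.+1).
Proof.
move=> k_gt1 le_kn.
have irr : irreflexive (@cycle_graph k.+1) by apply: cycle_graph_irr; apply: ltnW.
have no_copy : ~~ has_properly_colored_copy (@nested_coloring k n) (@cycle_graph k.+1).
  apply/negP => /existsP[g /andP[/injectiveP g_inj /forallP gP]].
  (* The largest vertex of the copy is at least [k], since [k.+1] vertices do not fit below [k]; so
     both its edges get the color [inr (g u)]. *)
  pose u := [arg max_(i > ord0) (g i : nat)].
  have u_max i : g i <= g u by rewrite /u; case: arg_maxnP => // j _; apply.
  have k_le_u : k <= g u.
    rewrite leqNgt; apply/negP => lt_uk.
    pose h (i : 'I_k.+1) := Ordinal (leq_ltn_trans (u_max i) lt_uk).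
    have h_inj : injective h by move=> i j [/val_inj/g_inj].
    by have := leq_card h h_inj; rewrite !card_ord ltnn.
  have /forallP/(_ (ordS u))/forallP/(_ (ord_pred u)) := gP u.
  rewrite !nested_coloring_max // eqxx implybF => /negP[].
  rewrite /cycle_graph /= ord_predK !eqxx orbT /=; apply/eqP.
  (* If successor and predecessor agreed, [u + 2] would equal [u] modulo [k.+1], which is at least
     3. *)
  move=> /(congr1 (@ordS k.+1)); rewrite ord_predK => /(congr1 val) /=.
  rewrite -addn1 modnDml addn1 -addn2 => E.
  have: u + 2 == u + 0 %[mod k.+1] by rewrite E addn0 modn_small.
  by rewrite eqn_modDl mod0n modn_small.
apply: leq_trans (pr_ub irr no_copy).
pose L1 :=
  [seq inl nat (widen_ord le_kn @: (A : {set 'I_k})) | A : {set 'I_k} in edges k].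
pose L2 := [seq inr {set 'I_n} m | m <- iota k (n - k)].
have -> : 'C(k, 2) + (n - k) = size (L1 ++ L2).
  by rewrite size_cat !size_map size_iota -cardE card_draws card_ord.
have w_inj : injective (widen_ord le_kn) by move=> i j /(congr1 val) /= /val_inj.
apply: uniq_leq_size.
  rewrite cat_uniq !map_inj_uniq ?enum_uniq ?iota_uniq ?andbT /=.
  - by apply/hasPn => x /mapP[m _ ->]; apply/negP => /mapP[].
  - by move=> m m' [].
  - by move=> A B [] /imset_inj; apply.
move=> x; rewrite mem_cat mem_undup => /orP[/imageP[A] | /mapP[m]].
  rewrite inE => A2 ->; apply/imageP; exists (widen_ord le_kn @: A).
    by rewrite inE card_imset.
  have k_gt0 : 0 < k by exact: ltnW.
  rewrite /nested_coloring ifT // -[X in _ < X](prednK k_gt0) ltnS.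
  apply/bigmax_leqP => i /imsetP[j _ ->] /=.
  by rewrite -ltnS prednK ?ltn_ord.
rewrite mem_iota subnKC // => /andP[km mn] ->; apply/imageP.
have n_gt0 : 0 < n by apply: leq_ltn_trans mn.
have m_gt0 : 0 < m by apply: leq_trans km; apply: ltnW.
(* Vertex [0] is below every added vertex [m], so this edge has color [inr m]. *)
exists [set Ordinal mn; Ordinal n_gt0].
  by rewrite inE cards2 -val_eqE /= -lt0n m_gt0.
by rewrite nested_coloring_max.
Qed.

Theorem theorem4 :
  (forall n : nat, 5 <= n -> pr n (@cycle_graph 5) = n + 2) /\
  (forall n : nat, 6 <= n -> pr n (@cycle_graph 6) = n + 5).
Proof.
have prE k n : 1 < k -> k < n -> (forall (V : finType) (C : eqType) (f : {set V} -> C),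
    no_proper_cycle f k.+1 ->
    (forall x, exists p q, cherry f x p q) -> #|V| < k.+1) ->
    pr n (@cycle_graph k.+1) = 'C(k, 2) + (n - k).
  move=> k_gt1 lt_kn cherries_lt; apply/eqP.
  by rewrite eqn_leq pr_cycle_le ?pr_cycle_ge // ltnW.
split=> n le_n.
  rewrite (prE 4) //; last exact: cherries_card_lt5.
  by rewrite (_ : 'C(4, 2) = 2 + 4) // -addnA subnKC 1?addnC // ltnW.
rewrite (prE 5) //; last exact: cherries_card_lt6.
by rewrite (_ : 'C(5, 2) = 5 + 5) // -addnA subnKC 1?addnC // ltnW.
Qed.
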